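(* Let $M[\mathbf{G},Q]$ be a finite completely simple semigroup (presented as a Rees matrix semigroup over a group $\mathbf{G}$ with matrix $Q$) that is not orthodox (equivalently, is not isomorphic to a direct product of $\mathbf{G}$ with a rectangular band). Then $M[\mathbf{G},Q]$ is inherently nondualisable.
   Context: Rees matrix semigroup: for a group $\mathbf{G}$, nonempty sets $I,\Lambda$ and a $\Lambda\times I$ matrix $Q$ with entries in $G$, $M[\mathbf{G},Q]$ is the semigroup on $I\times G\times\Lambda$ with $(i,g,\lambda)(j,h,\rho)=(i,gQ_{\lambda,j}h,\rho)$. Every completely simple semigroup is isomorphic to one of this form. A semigroup is regular if for every $s$ there is $t$ with $sts=s$; it is orthodox if it is regular and its idempotents form a subsemigroup. A rectangular band is a semigroup isomorphic to $I\times\Lambda$ with multiplication $(i,\lambda)(j,\rho)=(i,\rho)$. Semigroups are algebras with a single binary operation. Duality notions. Let $\mathbf{M}$ be a finite algebra and $\mathcal{Q}=\mathsf{ISP}(\mathbf{M})$ the quasivariety it generates (isomorphic copies of subalgebras of direct powers of $\mathbf{M}$). An alter ego $\mathbb{M}$ of $\mathbf{M}$ is a structure on the same universe $M$, carrying the discrete topology and some finitary operations, partial operations and relations, such that each $n$-ary operation is a homomorphism $\mathbf{M}^n\to\mathbf{M}$, each $n$-ary relation is a subalgebra of $\mathbf{M}^n$, and each $n$-ary partial operation is a homomorphism from a subalgebra of $\mathbf{M}^n$ into $\mathbf{M}$. Let $\mathcal{X}=\mathsf{IS_cP^+}(\mathbb{M})$ be the class of topologically and algebraically isomorphic copies of closed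 substructures of powers of $\mathbb{M}$ over nonempty index sets (product topology, pointwise structure). For $\mathbf{A}\in\mathcal{Q}$, $D(\mathbf{A})=\hom(\mathbf{A},\mathbf{M})$, a closed substructure of $\mathbb{M}^A$; for $\mathbb{A}\in\mathcal{X}$, $E(\mathbb{A})$ is the algebra of continuous homomorphisms (structure-preserving maps) $\mathbb{A}\to\mathbb{M}$, a subalgebra of $\mathbf{M}^{\mathbb{A}}$. $\mathbb{M}$ yields a duality on $\mathbf{A}$ if the (always injective) evaluation homomorphism $e:\mathbf{A}\to E(D(\mathbf{A}))$, $e_a(x)=x(a)$, is an isomorphism. $\mathbf{M}$ is dualisable (admits a natural duality) if some alter ego of $\mathbf{M}$ yields a duality on every $\mathbf{A}\in\mathcal{Q}$; otherwise it is nondualisable. A finite algebra $\mathbf{M}$ is inherently nondualisable if $\mathbf{M}\notin\mathsf{ISP}(\mathbf{N})$ for every finite dualisable algebra $\mathbf{N}$. *)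

(* Defs.v *)
From HB Require Import structures.
From mathcomp Require Import all_boot all_fingroup.
From mathcomp Require Import boolp classical_sets functions cardinality.
From mathcomp Require Import topology.

Set Implicit Arguments.
Unset Strict Implicit.
Unset Printing Implicit Defensive.

Local Open Scope classical_set_scope.
Local Open Scope group_scope.

(* An algebra with a single binary operation is a [magmaType] (no axioms).
   Since ISP(N) contains only algebras of the same type as N, the notions of
   duality theory used below only ever concern such algebras. *)

Definition submagma (T : magmaType) (B : set T) : Prop :=
  forall x y, B x -> B y -> B (x * y).

Definition isomorphic (S T : magmaType) : Prop :=
  exists f : {multiplicative S -> T}, bijective f.

(** ** Semigroups *)

Definition regular (S : semigroupType) : Prop :=
  forall s : S, exists t : S, s * t * s = s.

Definition idempotents (S : magmaType) : set S := [set e | e * e = e].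

Definition orthodox (S : semigroupType) : Prop :=
  regular S /\ submagma (@idempotents S).

Definition rect (I L : Type) : Type := (I * L)%type.

HB.instance Definition _ (I L : Type) :=
  hasMul.Build (rect I L) (fun x y => (x.1, y.2)).

Definition rectangular_band (B : magmaType) : Prop :=
  exists I L : Type, isomorphic B (rect I L).

(* The Rees matrix semigroup M[G, Q], for the group G of all elements of [gT];
   the rows of Q are indexed by L and its columns by I. *)
Definition rees (I L : finType) (gT : finGroupType) (Q : L -> I -> gT) : Type :=
  (I * gT * L)%type.

Definition rees_mul (I L : finType) (gT : finGroupType) (Q : L -> I -> gT)
    (x y : rees Q) : rees Q :=
  let: (i, g, l) := x in let: (j, h, r) := y in (i, g * Q l j * h, r).

Lemma rees_mulA (I L : finType) (gT : finGroupType) (Q : L -> I -> gT) :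
  associative (@rees_mul I L gT Q).
Proof. by move=> [[i g] l] [[j h] r] [[k u] s]; rewrite /= !mulgA. Qed.

HB.instance Definition _ (I L : finType) (gT : finGroupType)
    (Q : L -> I -> gT) := Finite.copy (rees Q) (I * gT * L)%type.
HB.instance Definition _ (I L : finType) (gT : finGroupType)
    (Q : L -> I -> gT) := hasMul.Build (rees Q) (@rees_mul I L gT Q).
HB.instance Definition _ (I L : finType) (gT : finGroupType)
    (Q : L -> I -> gT) := Magma_isSemigroup.Build (rees Q) (@rees_mulA I L gT Q).

(** ** Powers and quasivarieties *)

(* The power M^S carries the pointwise multiplication and the product of the
   discrete topologies. *)
Definition power (S M : Type) : Type := S -> M.

HB.instance Definition _ (S : Type) (M : magmaType) :=
  hasMul.Build (power S M) (fun x y s => x s * y s).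
HB.instance Definition _ (S : Type) (M : choiceType) :=
  Topological.copy (power S M) {ptws S -> discrete_topology M}.

(* Algebras are nonempty; the index set S of a power may be empty, so that
   ISP(M) contains the trivial algebras. *)
Definition ISP (M A : magmaType) : Prop :=
  inhabited A /\
  exists (S : Type) (f : {multiplicative A -> power S M}), injective f.

(** ** Alter egos and dualities *)

(* A partial operation is an option-valued function, undefined where its value
   is None. Being a homomorphism from a subalgebra of M^n into M means
   that its domain is closed under products and that it preserves them. *)
Definition partial_hom (n : nat) (M : magmaType)
    (h : power 'I_n M -> option M) : Prop :=
  forall x y u v, h x = Some u -> h y = Some v -> h (x * y) = Some (u * v).

Record alter_ego (M : magmaType) := AlterEgo {
  ops : forall n, set {multiplicative power 'I_n M -> M};
  partial_ops : forall n, set (power 'I_n M -> option M);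
  rels : forall n, set (set (power 'I_n M));
  partial_opsP : forall n h, @partial_ops n h -> partial_hom h;
  relsP : forall n r, @rels n r -> submagma r
}.

(* [preserving MM phi]: the map phi from X to M is structure-preserving, where
   X, a substructure of MM^S, carries the pointwise structure. [coord x s] is
   the n-tuple of the coordinates at s of the n-tuple x of elements of X. *)
Definition coord (S M : Type) (X : set (power S M)) (n : nat)
    (x : 'I_n -> X) (s : S) : power 'I_n M := fun i => val (x i) s.

Definition preserving (M : magmaType) (MM : alter_ego M) (S : Type)
    (X : set (power S M)) (phi : X -> M) : Prop :=
  [/\ forall n (f : {multiplicative power 'I_n M -> M}), ops MM f ->
        forall (x : 'I_n -> X) (z : X),
          (forall s, val z s = f (coord x s)) -> phi z = f (phi \o x),
      forall n (h : power 'I_n M -> option M), partial_ops MM h ->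
        forall (x : 'I_n -> X) (z : X),
          (forall s, h (coord x s) = Some (val z s)) ->
          h (phi \o x) = Some (phi z)
    & forall n (r : set (power 'I_n M)), rels MM r ->
        forall x : 'I_n -> X, (forall s, r (coord x s)) -> r (phi \o x)].

Definition dual_space (M A : magmaType) : set (power A M) :=
  [set x : A -> M | {morph x : a b / a * b}].
Arguments dual_space : clear implicits.

Definition dual_algebra (M : ChoiceMagma.type) (MM : alter_ego M) (S : Type)
    (X : set (power S M)) : set (power X M) :=
  [set phi : X -> M |
    continuous (phi : X -> discrete_topology M) /\ preserving MM phi].

Definition evaluation (M A : magmaType) (a : A) : power (dual_space M A) M :=
  fun x => val x a.

Definition yields_duality_on (M : ChoiceMagma.type) (MM : alter_ego M)
    (A : magmaType) : Prop :=
  set_bij [set: A] (dual_algebra MM (X := dual_space M A)) (@evaluation M A).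

Definition dualisable (M : ChoiceMagma.type) : Prop :=
  exists MM : alter_ego M, forall A : magmaType,
    ISP M A -> yields_duality_on MM A.

Definition inherently_nondualisable (M : ChoiceMagma.type) : Prop :=
  forall N : ChoiceMagma.type, finite_set [set: N] -> dualisable N -> ~ ISP N M.

(* Main.v *)
From HB Require Import structures.
Require Import Defs.
From mathcomp Require Import all_boot all_fingroup.
From mathcomp Require Import boolp classical_sets functions cardinality.
From mathcomp Require Import topology cyclic.

(* Suppose that N is finite and dualisable, that A is in ISP(N), and that w_0,
   w_1, ... in A are such that every homomorphism x : A -> N is constant on the
   w_k up to boundedly many k. Sending x to that constant value agrees on each
   finite set of homomorphisms with evaluation at some w_k, so it is continuous
   and structure-preserving; by duality it is evaluation at an element of A.
   To contradict this, A must lack the pointwise limit of the w_k.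

   If Q is not of "rank one", M = M[G, Q] contains a copy of the Rees semigroup
   {0, 1} x <c> x {0, 1} over the matrix (1, 1; 1, c), c <> 1. Take as
   coordinates the unordered pairs {k, l} of naturals, k = l allowed, and a
   point at infinity. Let S_k be the set of pairs containing k, and T the set of
   pairs {k, tau k} for an involution tau of the naturals, so that S_k and T
   meet in the single pair {k, tau k}. In a power of M, the elements given by
   these sets (all containing infinity) multiply to w_{k, tau k}, which is c at
   {k, tau k} and at infinity, and 1 elsewhere. A homomorphism x to a finite
   algebra identifies most elements S_k with another S_k', and taking tau to be
   the identity or the transposition (k l) then makes x constant on most
   w_k := w_{k, k}. In the algebra A generated by these elements the exponent of
   c at infinity is the sum of the other exponents, so A does not contain the
   limit of the w_k, which is c at infinity and 1 elsewhere. *)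

Set Implicit Arguments.
Unset Strict Implicit.
Unset Printing Implicit Defensive.

Local Open Scope classical_set_scope.
Local Open Scope group_scope.

(** * Ghost points from a duality *)

Lemma avoid_small_preds (J : finType) (E : J -> pred nat) (m K : nat) :
  (forall j s, uniq s -> all (E j) s -> (size s <= m)%N) ->
  exists k, [/\ (K <= k)%N, (k <= K + #|J| * m)%N & forall j, ~~ E j k].
Proof.
(* Pigeonhole: each [E j] holds at no more than [m] of these [#|J| * m + 1] naturals. *)
move=> Em; set s := iota K (#|J| * m).+1.
have [/hasP[k ks /forallP Ek]|/hasPn noE] :=
    boolP (has (fun k => [forall j, ~~ E j k]) s).
  by exists k; move: ks; rewrite mem_iota addnS ltnS => /andP[]; split.
have count_le : (size s <= \sum_j count (E j) s)%N.
  elim: s noE => //= k s IH noE.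
  have /forallPn[j] := noE k (mem_head _ _); rewrite negbK => Ejk.
  rewrite big_split -add1n leq_add //.
    by rewrite (bigD1 j) //= Ejk.
  by apply: IH => l ls; apply: noE; rewrite inE ls orbT.
have: (\sum_j count (E j) s <= \sum_(j : J) m)%N.
  apply: leq_sum => j _; rewrite -size_filter; apply: (Em j).
    exact/filter_uniq/iota_uniq.
  exact: filter_all.
by rewrite sum_nat_const => /(leq_trans count_le); rewrite size_iota ltnn.
Qed.

Lemma near_eq_dual_space (N : ChoiceMagma.type) (A : magmaType) (J : finType)
    (w : J -> A) (x : dual_space N A) :
  \forall y \near x, forall j, val y (w j) = val x (w j).
Proof.
apply: (@filter_forall _ _ _ (nbhs x)) => j.
have near_val : nbhs (val x : power A N) [set f | f (w j) = val x (w j)].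
  apply: (@proj_continuous {classic A} (fun=> discrete_topology N) (w j) (val x)
    [set v | v = val x (w j)]).
  by rewrite nbhs_principalE.
exact: (@initial_continuous _ (power A N) (val : dual_space N A -> _) x _
  near_val).
Qed.

Section GhostPoint.

Variables (N : ChoiceMagma.type) (A : magmaType) (w : nat -> A) (m : nat).
Hypothesis dualN : dualisable N.
Hypothesis A_ISP : ISP N A.
Hypothesis almost_constant : forall x : dual_space N A, exists v : N,
  forall s : seq nat, uniq s -> all (fun k => val x (w k) != v) s ->
  (size s <= m)%N.

Lemma ghost_point : exists a : A, forall (x : dual_space N A) (K : nat),
  exists2 k, (K <= k)%N & val x a = val x (w k).
Proof.
have [MM /(_ _ A_ISP) [_ _ onto]] := dualN.
have [alpha alphaP] := choice almost_constant.
have agree (J : finType) (x : J -> dual_space N A) (K : nat) :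
    exists k, [/\ (K <= k)%N, (k <= K + #|J| * m)%N &
                  forall j, val (x j) (w k) = alpha (x j)].
  have [k [Kk kK kx]] := @avoid_small_preds J
    (fun j k => val (x j) (w k) != alpha (x j)) m K (fun j => alphaP (x j)).
  by exists k; split => // j; apply/eqP; rewrite -[_ == _]negbK.
have agreeI n (x : 'I_n -> dual_space N A) (z : dual_space N A) : exists k,
    val z (w k) = alpha z /\ coord x (w k) = alpha \o x.
  have [k [_ _ kx]] := agree (option 'I_n) (fun o => oapp x z o) 0%N.
  by exists k; split; [exact: kx None|apply/funext => i; exact: kx (Some i)].
have: dual_algebra MM (X := dual_space N A) alpha.
  split.
    move=> x U Ux.
    (* Some [k < B] serves both [x] and [y], so agreement at the finitely many [w i] with [i < B]
       forces [alpha y = alpha x]. *)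
    pose B := (0 + #|{: bool}| * m).+1.
    have := near_eq_dual_space (fun i : 'I_B => w i) x.
    apply: (@filterS _ (nbhs x)) => y yx.
    have [k [_ kB kxy]] := agree bool (fun b => if b then x else y) 0%N.
    have ayx : alpha y = alpha x.
      rewrite -(kxy true) -(kxy false) /=.
      exact: (yx (Ordinal (kB : (k < B)%N))).
    by rewrite /= ayx; apply: nbhs_singleton Ux.
  split=> n.
  - move=> f _ x z zf; have [k [<- <-]] := agreeI n x z; exact: zf.
  - move=> h _ x z zh; have [k [<- <-]] := agreeI n x z; exact: zh.
  - move=> r _ x xr.
    have [k [_ _ kx]] := agree 'I_n x 0%N.
    by have <- : coord x (w k) = alpha \o x by apply/funext.
move=> /onto[a _ ea]; exists a => x K.
have [k [Kk _ /(_ tt) kx]] := agree unit (fun=> x) K.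
by exists k => //; rewrite kx -ea.
Qed.

End GhostPoint.

(** * Subalgebras of powers *)

Definition submagma_type (T : magmaType) (B : set T) (clB : submagma B) :
    Type := {x : T | B x}.

HB.instance Definition _ (T : magmaType) (B : set T) (clB : submagma B) :=
  hasMul.Build (submagma_type clB) (fun x y =>
    exist B (sval x * sval y) (clB _ _ (svalP x) (svalP y))).

Lemma ISP_submagma (N M : magmaType) (S : Type) (B : set (power S M))
    (clB : submagma B) : ISP N M -> B !=set0 -> ISP N (submagma_type clB).
Proof.
move=> [_ [U [f f_inj]]] [b Bb]; split; first by constructor; exists b.
pose g (x : submagma_type clB) : power (U * S) N :=
  fun us => f (sval x us.2) us.1.
have gM : {morph g : x y / x * y}.
  by move=> x y; apply/funext => us; rewrite /g /= gmulfM.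
pose gmul := isMultiplicative.Build (submagma_type clB) (power (U * S) N) g gM.
pose h : {multiplicative submagma_type clB -> power (U * S) N} :=
  HB.pack g gmul.
exists (U * S)%type, h => -[x Bx] [y By] gxy; apply: eq_exist.
apply/funext => s; apply: f_inj; apply/funext => u.
exact: (congr1 (fun h => h (u, s)) gxy).
Qed.

(** * Stars, matchings and their meets *)

Definition swap (a b k : nat) : nat :=
  if k == a then b else if k == b then a else k.

Lemma swapK a b : involutive (swap a b).
Proof.
move=> k; rewrite /swap; case: (eqVneq k a) => [->|ka].
  by case: eqVneq => [//|_]; rewrite eqxx.
case: (eqVneq k b) => [->|kb]; first by rewrite eqxx.
by rewrite (negPf ka) (negPf kb).
Qed.

(** [L k], [T a b] and [W k l] are the images under a homomorphism of the star at [k], the matching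
    of [swap a b] and the element of the pair [{k, l}]. Indices that share their [L]-value with
    another one all get the same [W k k]; the remaining, lonely ones have distinct [L]-values, so
    there are at most [m] of them. *)
Lemma products_almost_constant (N : ChoiceMagma.type) (L : nat -> N)
    (T W : nat -> nat -> N) (m : nat) :
  (forall k l, W k l = W l k) ->
  (forall a b k, L k * T a b = W k (swap a b k)) ->
  (forall s, uniq (map L s) -> (size s <= m)%N) ->
  exists v : N, forall s : seq nat, uniq s -> all (fun k => W k k != v) s ->
  (size s <= m)%N.
Proof.
move=> Wsym LT finN; pose lonely k := forall k', L k' = L k -> k' = k.
have diag k l : L k = L l -> W k k = W l l.
  have diagE n : W n n = L n * T 0%N 0%N.
    by rewrite LT /swap; case: (eqVneq n 0%N) => [->|].
  by move=> kl; rewrite !diagE kl.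
have offdiag k l : ~ lonely k -> k <> l -> W k l = W k k \/ W k k = W l l.
  move=> /existsNP[k' /not_implyP[Lk' /eqP k'k]] /eqP kl.
  have [k'l|k'l] := eqVneq k' l; first by right; rewrite -k'l (diag _ _ Lk').
  (* [swap k l] fixes [k'], so replacing [L k] by [L k'] turns [W k l] into [W k' k']. *)
  have := LT k l k; rewrite -Lk' LT /swap eqxx (negPf k'k) (negPf k'l) => <-.
  by left; exact: diag.
have const k l : ~ lonely k -> ~ lonely l -> W k k = W l l.
  move=> lk ll; have [->//|/eqP kl] := eqVneq k l.
  have [Wkl|//] := offdiag k l lk kl.
  by have [Wlk|//] := offdiag l k ll (nesym kl); rewrite -Wkl Wsym.
have size_lonely s : uniq s -> {in s, forall k, lonely k} -> (size s <= m)%N.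
  move=> s_uniq s_lonely; apply: finN; rewrite map_inj_in_uniq // => k l _ ls.
  exact: s_lonely.
have [[k0 k0P]|all_lonely] := pselect (exists k, ~ lonely k).
  exists (W k0 k0) => s s_uniq /allP sW; apply: size_lonely => // k ks.
  by apply: contrapT => /const /(_ k0P) /eqP; apply/negP/sW.
(* The value is arbitrary: here every list of distinct indices has size at most [m]. *)
exists (L 0%N) => s s_uniq _; apply: size_lonely => // k _.
by apply: contrapT => ?; apply: all_lonely; exists k.
Qed.

Definition star (r : option nat) : pred (nat * nat) :=
  fun p => if r is Some k then (k == p.1) || (k == p.2) else false.

(* [Some (a, b)] stands for the involution [swap a b] and [None] for the empty
   set, which is not a matching. An unordered pair is coded by p with
   [p.1 <= p.2]; no matching contains any other p. *)
Definition matching (t : option (nat * nat)) : pred (nat * nat) :=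
  fun p => if t is Some (a, b) then (p.1 <= p.2)%N && (swap a b p.1 == p.2)
           else false.

Definition upair (k l : nat) : nat * nat := (minn k l, maxn k l).

Definition meet (r : option nat) (t : option (nat * nat)) : seq (nat * nat) :=
  match r, t with
  | Some k, Some (a, b) => [:: upair k (swap a b k)]
  | _, _ => [::]
  end.

Lemma count_meet r t p :
  count_mem p (meet r t) = (star r p && matching t p) :> nat.
Proof.
case: r t => [k|] [[a b]|] //=; last by rewrite andbF.
rewrite addn0; congr nat_of_bool; case: p => p q /=.
apply/eqP/andP => [[<- <-]|[kpq /andP[pq /eqP spq]]].
  by case: (leqP k (swap a b k)) => [|/ltnW] kl;
    rewrite !eqxx ?orbT ?swapK ?eqxx kl.
case/orP: kpq => /eqP ->; rewrite -spq ?swapK spq /upair.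
  by rewrite (minn_idPl pq) (maxn_idPr pq).
by rewrite (minn_idPr pq) (maxn_idPl pq).
Qed.

Lemma size_meet r t : size (meet r t) = (isSome r && isSome t) :> nat.
Proof. by case: r t => [k|] [[a b]|]. Qed.

Lemma size_sum_count (T : eqType) (s : seq T) :
  size s = (\sum_(x <- undup s) count_mem x s)%N.
Proof.
rewrite -sum1_size -big_undup_iterop_count; apply: eq_bigr => x _.
by rewrite Monoid.iteropE iter_addn_0 mul1n.
Qed.

(** * The two-by-two case *)

Section TwoByTwo.

(** [el i x l] plays the role of [(i, c^x, l)] over the matrix (1, 1; 1, c), and [d] that of the
    order of [c]. *)
Variables (M : ChoiceMagma.type) (el : bool -> nat -> bool -> M) (d : nat).
Hypothesis d_gt1 : (1 < d)%N.
Hypothesis elM : forall i x l j y r,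
  el i x l * el j y r = el i (x + (l && j) + y)%N r.
Hypothesis el_inj : forall i x l j y r, el i x l = el j y r ->
  [/\ i = j, x = y %[mod d] & l = r].

(* A code (t, s, r) lists the pairs at which a factor c has been produced, with
   multiplicity; concatenation of these lists makes the exponent at infinity,
   [size s], the sum of the exponents [count_mem p s]. The point at infinity is
   the coordinate [None]. *)
Definition code : Type := option (nat * nat) * seq (nat * nat) * option nat.

Definition decode (c : code) : power (option (nat * nat)) M :=
  let: (t, s, r) := c in fun z =>
  if z is Some p then el (matching t p) (count_mem p s) (star r p)
  else el (isSome t) (size s) (isSome r).

Lemma decodeM t s r t' s' r' :
  decode (t, s, r) * decode (t', s', r') = decode (t, s ++ meet r t' ++ s', r').
Proof.
apply/funext => -[p|] /=; rewrite {1}/mul /= elM.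
  by rewrite !count_cat count_meet addnA.
by rewrite !size_cat size_meet addnA.
Qed.

Lemma submagma_decode : submagma (range decode).
Proof.
move=> _ _ [[[t s] r] _ <-] [[[t' s'] r'] _ <-]; rewrite decodeM.
exact: imageT.
Qed.

Let A := submagma_type submagma_decode.

Let elt (c : code) : A := exist _ (decode c) (imageT decode c).

Let star_elt k := elt (None, [::], Some k).
Let matching_elt a b := elt (Some (a, b), [::], None).
Let pair_elt k l := elt (None, [:: upair k l], None).

Lemma star_matching a b k :
  star_elt k * matching_elt a b = pair_elt k (swap a b k).
Proof. by apply: eq_exist; exact: decodeM. Qed.

Lemma two_by_two_inherently_nondualisable : inherently_nondualisable M.
Proof.
move=> N /finite_seqP[e eN] dualN M_ISP.
have A_ISP : ISP N A.
  apply: ISP_submagma M_ISP _.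
  by exists (decode (None, [::], None)); exact: imageT.
have almost_const (x : dual_space N A) : exists v : N, forall s : seq nat,
    uniq s -> all (fun k => val x (pair_elt k k) != v) s ->
    (size s <= size e)%N.
  apply: (@products_almost_constant N (fun k => val x (star_elt k))
    (fun a b => val x (matching_elt a b)) (fun k l => val x (pair_elt k l))).
  - by move=> k l; rewrite /pair_elt /upair minnC maxnC.
  - by move=> a b k; rewrite -star_matching (set_valP x).
  - move=> s s_uniq; rewrite -(size_map (fun k => val x (star_elt k))).
    apply: uniq_leq_size => // v _.
    by have : [set: N] v by []; rewrite eN.
have [a ghost] := ghost_point dualN A_ISP almost_const.
have [[[t s] r] _ ea] := svalP a.
have [_ [S [f f_inj]]] := M_ISP.
(* Coordinate [z] of the power of [M], followed by coordinate [u] of the embedding of [M] into a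
   power of [N], is a homomorphism from [A] to [N]. *)
have coordE z u (K : nat) : exists2 k, (K <= k)%N &
    f (decode (t, s, r) z) u = f (decode (None, [:: upair k k], None) z) u.
  have morph : ((fun b : A => f (sval b z) u) : power A N) \in dual_space N A.
    by apply: mem_set => b c; rewrite /= gmulfM.
  have [k Kk] := ghost (exist (fun x => x \in dual_space N A) _ morph) K.
  by exists k => //; rewrite ea.
have el_pair p :
    el (matching t p) (count_mem p s) (star r p) = el false 0 false.
  apply: f_inj; apply/funext => u.
  (* Taking [k] beyond [p.1] keeps [upair k k] different from [p]. *)
  have [k pk ->] := coordE (Some p) u p.1.+1.
  rewrite /= /upair minnn maxnn addn0.
  by case: eqP pk => // <-; rewrite ltnn.
have [t0 size1 r0] : [/\ isSome t = false, size s = 1 %[mod d] &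
    isSome r = false].
  apply: el_inj; apply: f_inj; apply/funext => u.
  (* At infinity every [pair_elt k k] has exponent 1, so any [k] will do. *)
  by have [k _ ->] := coordE None u 0%N.
have count0 p : (d %| count_mem p s)%N.
  by have [_ /eqP] := el_inj (el_pair p); rewrite mod0n.
have: (d %| size s)%N by rewrite size_sum_count; apply: dvdn_sum.
by rewrite /dvdn size1 modn_small.
Qed.

End TwoByTwo.

(** * Orthodoxy of Rees matrix semigroups *)

Lemma rees_idempotentP (gT : finGroupType) (I L : finType) (Q : L -> I -> gT)
    i g l : idempotents ((i, g, l) : rees Q) <-> Q l i * g = 1.
Proof.
rewrite /idempotents /=; split=> [[] /eqP|Qg]; last first.
  by congr (_, _, _); rewrite -mulgA Qg mulg1.
by rewrite -mulgA -[X in _ == X]mulg1 (inj_eq (mulgI g)) => /eqP.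
Qed.

Lemma rees_regular (gT : finGroupType) (I L : finType) (Q : L -> I -> gT) :
  regular (rees Q).
Proof.
move=> [[i g] l]; exists (i, (Q l i)^-1 * g^-1 * (Q l i)^-1, l).
by congr (_, _, _); rewrite !mulgA mulgK mulgV mul1g mulVg mul1g.
Qed.

(** The idempotents are the triples [(k, (Q m k)^-1, m)]; the equation says that the product of two
    of them is idempotent. *)
Lemma orthodox_reesP (gT : finGroupType) (I L : finType) (Q : L -> I -> gT) :
  orthodox (rees Q) <->
  forall i j l r, Q l i * (Q r i)^-1 * Q r j * (Q l j)^-1 = 1.
Proof.
split=> [[_ idemM] i j l r|Q1].
  have idem_inv k m : idempotents ((k, (Q m k)^-1, m) : rees Q).
    by apply/rees_idempotentP; rewrite mulgV.
  have /rees_idempotentP := idemM _ _ (idem_inv i r) (idem_inv j l).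
  by rewrite !mulgA.
split; first exact: rees_regular.
move=> [[i g] l] [[j h] r] /rees_idempotentP Qg /rees_idempotentP Qh.
apply/rees_idempotentP.
rewrite -(mulKg (Q l i) g) Qg mulg1 -(mulKg (Q r j) h) Qh mulg1 !mulgA.
exact: Q1.
Qed.

(** As [B] consists of idempotents, those of [hT * B] are the pairs with first entry 1. *)
Lemma rees_product_orthodox (gT hT : finGroupType) (I L : finType)
    (Q : L -> I -> gT) (B : magmaType) :
  rectangular_band B -> isomorphic (rees Q) (hT * B)%type -> orthodox (rees Q).
Proof.
move=> [J [K [b b_bij]]] [f f_bij].
have idemB (x : B) : x * x = x.
  by apply: (bij_inj b_bij); rewrite gmulfM; case: (b x).
have idem_fst x : idempotents x -> (f x).1 = 1.
  move=> xx; have := congr1 (fun x => (f x).1) xx.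
  rewrite /= gmulfM => /eqP.
  by rewrite -[X in _ == X]mulg1 (inj_eq (mulgI _)) => /eqP.
split; first exact: rees_regular.
move=> x y /idem_fst x1 /idem_fst y1; apply: (bij_inj f_bij).
rewrite /idempotents /= !gmulfM.
case: (f x) x1 (f y) y1 => [_ u] /= -> [_ v] /= ->.
suff: (1 * 1 * (1 * 1), u * v * (u * v)) = (1 * 1 : hT, u * v) by [].
by rewrite idemB !mulg1.
Qed.

(** The equation factors [Q l j] as [Q l i0 * (Q l0 i0)^-1] times [Q l0 j]; absorbing both factors
    into the group component makes the matrix trivial. *)
Lemma orthodox_rees_product (gT : finGroupType) (I L : finType)
    (Q : L -> I -> gT) (i0 : I) (l0 : L) :
  (forall i j l r, Q l i * (Q r i)^-1 * Q r j * (Q l j)^-1 = 1) ->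
  isomorphic (rees Q) (gT * rect I L)%type.
Proof.
move=> Q1.
pose f (x : rees Q) : (gT * rect I L)%type :=
  (Q l0 x.1.1 * x.1.2 * Q x.2 i0 * (Q l0 i0)^-1, (x.1.1, x.2)).
have fM : {morph f : x y / x * y}.
  move=> [[i g] l] [[j h] r]; congr (_, _).
  rewrite /f /=; have -> : Q l j = Q l i0 * (Q l0 i0)^-1 * Q l0 j.
    by rewrite -[LHS]mul1g -(Q1 i0 j l l0) mulgKV.
  by rewrite !mulgA.
pose fmul := isMultiplicative.Build (rees Q) (gT * rect I L)%type f fM.
pose F : {multiplicative rees Q -> (gT * rect I L)%type} := HB.pack f fmul.
exists F.
exists (fun y : gT * rect I L =>
  (y.2.1, (Q l0 y.2.1)^-1 * y.1 * Q l0 i0 * (Q y.2.2 i0)^-1, y.2.2)).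
  move=> [[i g] l]; congr (_, _, _) => /=.
  by rewrite !mulgA mulgKV mulgK mulVg mul1g.
move=> [g [i l]]; congr (_, _) => /=.
by rewrite !mulgA mulgV mul1g mulgKV mulgK.
Qed.

(** * Embedding the two-by-two case *)

Section Rees.

Variables (gT : finGroupType) (I L : finType) (Q : L -> I -> gT).
Variables (i0 i1 : I) (l0 l1 : L).

Let col (b : bool) := if b then i1 else i0.
Let row (b : bool) := if b then l1 else l0.
Let c := Q l0 i0 * (Q l1 i0)^-1 * Q l1 i1 * (Q l0 i1)^-1.

(** Normalising row [l0] and column [i0] to 1 turns the submatrix on these rows and columns into (1,
    1; 1, c); the outer factors undo this rescaling. *)
Let el (i : bool) (x : nat) (l : bool) : rees Q :=
  (col i, (Q l0 (col i))^-1 * c ^+ x * (Q l0 i0 * (Q (row l) i0)^-1), row l).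

Let elM i x l j y r : el i x l * el j y r = el i (x + (l && j) + y)%N r.
Proof.
have sandwich : Q l0 i0 * (Q (row l) i0)^-1 * Q (row l) (col j) *
    (Q l0 (col j))^-1 = c ^+ (l && j).
  case: l; case: j => //=.
  - by rewrite mulgKV mulgV.
  - by rewrite mulgV mul1g mulgV.
  - by rewrite mulgV mul1g mulgV.
by congr (_, _, _); rewrite !expgD -sandwich /= !mulgA.
Qed.

Lemma rees_inherently_nondualisable :
  c <> 1 -> inherently_nondualisable (rees Q).
Proof.
move=> c_neq1.
have c_gt1 : (1 < #[c])%N by rewrite order_gt1; apply/eqP.
have i01 : i0 != i1.
  by apply: contra_notN c_neq1 => /eqP ii; rewrite /c -ii mulgKV mulgV.
have l01 : l0 != l1.
  by apply: contra_notN c_neq1 => /eqP ll; rewrite /c -ll mulgV mul1g mulgV.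
apply: (two_by_two_inherently_nondualisable c_gt1 elM).
move=> i x l j y r [colE midE rowE].
have ij : i = j.
  by case: i j colE {midE} => -[] //= e01; rewrite e01 eqxx in i01.
have lr : l = r.
  by case: l r rowE {midE} => -[] //= e01; rewrite e01 eqxx in l01.
move: midE; rewrite ij lr => /mulIg/mulgI/eqP.
by rewrite eq_expg_mod_order => /eqP.
Qed.

End Rees.

Theorem theorem7p1 (gT : finGroupType) (I L : finType) (Q : L -> I -> gT)
    (I_gt0 : (0 < #|I|)%N) (L_gt0 : (0 < #|L|)%N) :
  (~ orthodox (rees Q) <->
   ~ exists B : magmaType,
       rectangular_band B /\ isomorphic (rees Q) (gT * B)%type) /\
  (~ orthodox (rees Q) -> inherently_nondualisable (rees Q)).
Proof.
have [[i0 _] [l0 _]] := (card_gt0P I_gt0, card_gt0P L_gt0).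
split; last first.
  move=> /orthodox_reesP.
  move=> /existsNP[i /existsNP[j /existsNP[l /existsNP[r]]]].
  exact: rees_inherently_nondualisable.
split; apply: contra_not.
- by move=> [B [bandB isoB]]; exact: rees_product_orthodox bandB isoB.
- move=> /orthodox_reesP Q1; exists (rect I L); split.
    by exists I, L, idfun; exists idfun.
  exact: orthodox_rees_product i0 l0 Q1.
Qed.
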